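(* Let $d\ge 1$. For $x=(x_1,\dots,x_d)\in\mathbb{Z}^d$ define $\alpha(x):=1$ if $|x_1|,\ldots,|x_d|$ have a unique maximum, and $\alpha(x):=0$ otherwise. For any rotor mechanism on $\mathbb{Z}^d$, there exists a recurrent rotor configuration such that, for the rotor walk started at $0$ with this initial configuration, for every integer $k\ge 0$ and every $x\in\mathbb{Z}^d$: just before the $(k+1)$st traversal from $0$ to $(1,0,\dots,0)$, the vertex $x$ has been entered exactly $$\Big[2d\,(k-\|x\|_\infty)+\alpha(x)\Big]^+$$ times.
   Context: $\mathbb{Z}^d$ denotes the graph with vertex set $\mathbb{Z}^d$ and an (undirected) edge between each pair of vertices at Euclidean distance $1$. $[t]^+=\max(t,0)$ and $\|x\|_\infty=\max_i|x_i|$. A rotor mechanism on a graph assigns to each vertex a fixed cyclic order of its neighbours. A rotor configuration assigns to each vertex one of its neighbours (the vertex its rotor points to). Given a rotor mechanism, an initial rotor configuration and a starting vertex for a particle, the rotor walk evolves in discrete time: at each step the rotor at the particle's current location is first incremented to point to the next neighbour in the cyclic order, and then the particle moves to this new neighbour. The walk traverses from $x$ to $y$ when the particle makes a step from $x$ to $y$; a vertex $x$ is entered each time the particle makes a step to $x$. The rotor walk is recurrent if it visits every vertex infinitely many times. A rotor configuration is called recurrent if the rotor walk with it as initial configuration is recurrent; on an infinite, connected, simple, undirected graph with all degrees finite, this does not depend on the starting vertex.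
   Formalization: For d=1 the value α(0) is taken to be 0 instead of the literal 1 (with α(0)=1 the claim fails at k=0: the origin would be entered once but neither neighbour ever); for d≥2 α is unchanged. *)

(* Defs.v *)
From HB Require Import structures.
From mathcomp Require Import all_boot all_order all_algebra.
Set Implicit Arguments. Unset Strict Implicit. Unset Printing Implicit Defensive.
Import Order.TTheory GRing.Theory Num.Theory.
Local Open Scope ring_scope.

Section RotorWalk.
Variables (V : eqType) (adj : rel V).

(* The cyclic order of the neighbours of [x] is given by a duplicate-free
   enumeration [m x] of them, read cyclically through [next (m x)]; two
   enumerations that differ by a rotation represent the same cyclic order. *)
Definition is_rotor_mechanism (m : V -> seq V) : Prop :=
  forall x, uniq (m x) /\ (forall y, (y \in m x) = adj x y).

Definition is_rotor_config (rho : V -> V) : Prop := forall x, adj x (rho x).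

Definition rotor_step (m : V -> seq V) (s : (V -> V) * V) : (V -> V) * V :=
  let: (rho, x) := s in
  let y := next (m x) (rho x) in
  ((fun z => if z == x then y else rho z), y).

Definition rotor_walk (m : V -> seq V) (rho : V -> V) (x0 : V) : nat -> V :=
  fun n => (iter n (rotor_step m) (rho, x0)).2.

Definition recurrent_walk (X : nat -> V) : Prop :=
  forall v N, exists2 n, (N <= n)%N & X n = v.

(* The starting vertex is irrelevant on the infinite connected locally finite
   graphs of interest, so recurrence is required from all of them. *)
Definition recurrent_config (m : V -> seq V) (rho : V -> V) : Prop :=
  forall x0, recurrent_walk (rotor_walk m rho x0).

(* Step number [n] is the one from [X n] to [X n.+1], so that the steps [i < n]
   are those made before it. *)
Definition traverses (X : nat -> V) (x y : V) (n : nat) : bool :=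
  (X n == x) && (X n.+1 == y).

Definition is_nth_traversal (X : nat -> V) (x y : V) (k n : nat) : Prop :=
  traverses X x y n /\ (\sum_(i < n.+1) traverses X x y i)%N = k.

Definition entries_before (X : nat -> V) (n : nat) (x : V) : nat :=
  (\sum_(i < n) (X i.+1 == x))%N.

End RotorWalk.

Section Lattice.
Variable d : nat.
Implicit Types x y : 'rV[int]_d.

(* Euclidean distance 1, with the square root removed. *)
Definition lattice_adj : rel 'rV[int]_d :=
  fun x y => \sum_(i < d) (x 0 i - y 0 i) ^+ 2 == 1.

Definition lattice_e1 : 'rV[int]_d := \row_(i < d) (i == 0%N :> nat)%:R.

Definition sup_norm x : nat := (\max_(i < d) `|x 0%R i|)%N.

Definition has_unique_max x : bool :=
  [exists i, [forall j, (j != i) ==> (`|x 0 j| < `|x 0 i|)]].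

(* The condition [x != 0] only matters for [d = 1]: for [1 < d] the entries of
   0 have no unique maximum (see [alphaE]).  For [d = 1] it is needed at the
   origin: with the value 1 there, the origin would have to be entered once,
   but neither of its neighbours, before the first traversal from 0 to 1. *)
Definition alpha x : nat := (x != 0) && has_unique_max x.

Lemma alphaE x : (1 < d)%N -> alpha x = has_unique_max x.
Proof.
move=> d_gt1; rewrite /alpha; have [->|//] := eqVneq x 0.
suff /negbTE-> : ~~ has_unique_max 0 by [].
apply/existsP => -[i /forallP lt_i].
have [j ji] : exists j, j != i.
  have /card_gt0P[j] : (0 < #|predC1 i|)%N.
    by rewrite cardC1 card_ord; case: (d) d_gt1 => [|[]].
  by exists j.
by have := lt_i j; rewrite ji /= !mxE ltxx.
Qed.

End Lattice.

(* Main.v *)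
(* Let [u k x] be the claimed number of entries. For x <> 0 whose entries have a
   unique maximum in absolute value, let the first exit from x be towards the
   neighbour of smaller sup norm; for other x <> 0 let the initial rotor
   point to a neighbour with one of the largest entries decreased. If every x
   is exited [u k x] times, the edge between x and y is then traversed (k -
   min (|x|, |y|))^+ times in either direction, so that as many particles
   enter x as leave it. The walk started at 0 therefore first violates the
   bound [u k] at 0 itself, after [u k 0] exits from 0. At that moment the
   bound is attained everywhere, because the last exits prescribed by [u k]
   lead to 0 without cycles. The same stopping argument works from every
   starting vertex x0, so x0 is exited [u k x0] times for all k, which gives
   recurrence. *)
Require Import Defs.
From HB Require Import structures.
From mathcomp Require Import all_boot all_order all_algebra zify.
Set Implicit Arguments. Unset Strict Implicit. Unset Printing Implicit Defensive.
Import Order.TTheory GRing.Theory Num.Theory.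
Local Open Scope ring_scope.

(** * Full turns of a cyclic order *)

Section Cyclic.
Variables (V : eqType) (s : seq V) (r : V).
Hypotheses (s_uniq : uniq s) (r_s : r \in s).

(** Once [s] is rotated so that [r] comes first, the successors of [r] run through the rest of the
    list and then return to [r]. *)
Lemma traject_next :
  exists2 t, perm_eq (rcons t r) s &
    traject (next s) (next s r) (size s) = rcons t r.
Proof.
case: (rot_to r_s) => i t rot_s; exists t.
  by rewrite perm_rcons -rot_s perm_rot.
have [n eq_n] : exists n, rcons t r = traject (next s) (next s r) n.
  apply/fpathP; have : uniq (rot i s) by rewrite rot_uniq.
  move=> /cycle_next; rewrite {2}rot_s /=; apply: sub_path => a b /=.
  by rewrite next_rot.
have <- : n = size s; last by rewrite eq_n.
by rewrite -(size_rot i) rot_s /= -(size_rcons t r) eq_n size_traject.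
Qed.

Lemma iter_next_sizeM q : iter (size s * q) (next s) r = r.
Proof.
elim: q => [|q IH]; rewrite ?muln0 // mulnS iterD IH -last_traject.
by have [t _ ->] := traject_next; rewrite last_rcons.
Qed.

Lemma sum_next_size z :
  (\sum_(i < size s) (iter i.+1 (next s) r == z) = (z \in s))%N.
Proof.
have [t perm_t eq_t] := traject_next.
rewrite -count_uniq_mem // -(permP perm_t) -eq_t -sum1_count [RHS]big_mkcond /=.
rewrite (big_nth (next s r)) size_traject big_mkord; apply: eq_bigr => i _.
by rewrite nth_traject // -iterSr; case: eqP.
Qed.

Lemma sum_next_sizeM z q :
  (\sum_(i < size s * q) (iter i.+1 (next s) r == z) = q * (z \in s))%N.
Proof.
elim: q => [|q IH]; first by rewrite muln0 big_ord0.
rewrite mulnS addnC big_split_ord /= IH mulSn addnC; congr (_ + _)%N.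
rewrite -sum_next_size; apply: eq_bigr => i _.
by rewrite addnC iterD iter_next_sizeM.
Qed.

End Cyclic.

(** * Exit and entry counts of a rotor walk on a symmetric graph *)

Section Walk.
Variables (V : eqType) (m : V -> seq V) (rho : V -> V) (x0 : V).
Hypothesis m_uniq : forall x, uniq (m x).
Hypothesis m_sym : forall x y, (y \in m x) = (x \in m y).
Hypothesis rho_m : forall x, rho x \in m x.

(** The rotor moves before the particle, so the [j]-th exit from [x], counted from 1, goes to
    [turns x j]. *)
Definition turns x j := iter j (next (m x)) (rho x).
Definition sent y x j := (\sum_(i < j) (turns y i.+1 == x))%N.
Local Notation X := (rotor_walk m rho x0).
Definition exits n x := (\sum_(i < n) (X i == x))%N.

Lemma turns_m x j : turns x j \in m x.
Proof. by rewrite /turns; elim: j => //= j IH; rewrite mem_next. Qed.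

Lemma sentS y x j : sent y x j.+1 = (sent y x j + (turns y j.+1 == x))%N.
Proof. by rewrite /sent big_ord_recr. Qed.

Lemma leq_sent y x j j' : (j <= j')%N -> (sent y x j <= sent y x j')%N.
Proof.
move=> /subnK <-; elim: (_ - _)%N => // n IH.
by rewrite addSn sentS (leq_trans IH) ?leq_addr.
Qed.

Lemma ltn_sent_turns y j j' : (j < j')%N ->
  (sent y (turns y j') j < sent y (turns y j') j')%N.
Proof.
by case: j' => // j' lt_j; rewrite sentS eqxx addn1 ltnS leq_sent.
Qed.

Lemma exitsS n x : exits n.+1 x = (exits n x + (X n == x))%N.
Proof. by rewrite /exits big_ord_recr. Qed.

Lemma rotor_walk_state n x :
  (iter n (rotor_step m) (rho, x0)).1 x = turns x (exits n x).
Proof.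
elim: n x => [|n IH] x; first by rewrite /exits big_ord0.
rewrite exitsS iterS /rotor_walk; move: IH; case: (iter n _ _) => f y /= IH.
by rewrite eq_sym; case: eqP => [->|_]; rewrite ?addn0 // addn1 IH.
Qed.

Lemma rotor_walkS n : X n.+1 = turns (X n) (exits n (X n)).+1.
Proof.
rewrite /rotor_walk iterS; have := rotor_walk_state n.
by rewrite /rotor_walk; case: (iter n _ _) => f y /= ->.
Qed.

(** Both sides count the visits to [x] at times 0 to [n]; the left splits off time 0, the right time
    [n]. *)
Lemma exits_conservation n x :
  (entries_before X n x + (x0 == x) = exits n x + (X n == x))%N.
Proof.
by rewrite -exitsS /exits big_ord_recl /= addnC.
Qed.

Lemma entries_sent n x :
  entries_before X n x = (\sum_(y <- m x) sent y x (exits n y))%N.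
Proof.
elim: n => [|n IH].
  rewrite /entries_before big_ord0 big1 // => y _.
  by rewrite /sent /exits !big_ord0.
rewrite /entries_before big_ord_recr /= [X in (X + _)%N]IH.
have step y : sent y x (exits n.+1 y)
    = (sent y x (exits n y) + (if y == X n then (X n.+1 == x : nat) else 0))%N.
  rewrite exitsS eq_sym; case: eqP => [->|_]; last by rewrite !addn0.
  by rewrite addn1 sentS rotor_walkS.
rewrite (eq_bigr _ (fun y _ => step y)) big_split /=; congr (_ + _)%N.
rewrite -big_mkcond /= -big_filter.
have [Xn_x|Xn_x] := boolP (X n \in m x).
by rewrite filter_pred1_uniq // big_seq1.
(* A step from outside [m x] cannot end at [x], so nothing is added on either side. *)
rewrite m_sym in Xn_x.
rewrite big1_seq => [|y].
  by case: eqP => // X_x; rewrite -X_x rotor_walkS turns_m in Xn_x.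
by rewrite mem_filter m_sym => /andP[_ /andP[/eqP->]]; rewrite (negPf Xn_x).
Qed.

Lemma leq_exits n x : (exits n x <= n)%N.
Proof.
elim: n => [|n IH]; first by rewrite /exits big_ord0.
by rewrite exitsS -addn1 leq_add ?leq_b1.
Qed.

Lemma exits_unbounded_recurrent :
  (forall v N, exists n, (N <= exits n v)%N) -> recurrent_walk X.
Proof.
move=> unb v N; have [n lt_n] := unb v N.+1.
have [/hasP[i]|/hasPn no_visit] := boolP (has (fun i => X i == v) (iota N n)).
  by rewrite mem_iota => /andP[le_i _] /eqP; exists i.
have /(_ n) : forall j, (j <= n -> exits (N + j) v <= N)%N.
  elim=> [_|j IH j_n]; first by rewrite addn0 leq_exits.
  rewrite addnS exitsS (negPf (no_visit _ _)) ?addn0 ?IH ?(ltnW j_n) //.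
  by rewrite mem_iota leq_addr ltn_add2l.
move=> /(_ (leqnn _)) le_N; have : (exits n v <= exits (N + n) v)%N.
  by elim: (N) => // N' /leq_trans; apply; rewrite addSn exitsS leq_addr.
by move=> /(leq_trans lt_n) /leq_trans /(_ le_N); rewrite ltnn.
Qed.

Lemma exits_unbounded_adj v w : w \in m v ->
  (forall N, exists n, (N <= exits n v)%N) ->
  forall N, exists n, (N <= exits n w)%N.
Proof.
(* [N.+1] full turns at [v] give [N.+1] entries to [w]; the last of these may not have been followed
   by an exit yet. *)
move=> w_v unb N; have [n le_n] := unb (size (m v) * N.+1)%N; exists n.
have /(leq_trans _) le_sent := leq_sent v w le_n.
have := exits_conservation n w; rewrite entries_sent.
rewrite (big_rem v) 1?m_sym //=.
have := le_sent N.+1; rewrite /sent sum_next_sizeM // w_v muln1 leqnn.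
by move=> /(_ isT); lia.
Qed.

(** * Stopping the walk at balanced exit counts *)

Section Balanced.
Variables (u : V -> nat) (s : seq V).
Hypothesis u_supp : forall x, (0 < u x)%N -> x \in s.
Hypothesis u_balanced : forall x, (\sum_(y <- m x) sent y x (u y) = u x)%N.

Lemma entries_le_balanced n x :
  (forall y, exits n y <= u y)%N -> (entries_before X n x <= u x)%N.
Proof.
move=> le_u; rewrite entries_sent -u_balanced.
by apply: leq_sum => y _; apply: leq_sent.
Qed.

(* Stop just before the first step that would make some exit count exceed [u];
   balance forces this to happen at the starting vertex. *)
Lemma least_action : exists n,
  [/\ X n = x0, exits n x0 = u x0 & forall x, (exits n x <= u x)%N].
Proof.
have step n : (forall i, (i < n)%N -> exits i (X i) < u (X i))%N ->
    forall x, (exits n x <= u x)%N.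
  elim: n => [|n IH] lt_u x; first by rewrite /exits big_ord0.
  rewrite exitsS; case: eqP => [<-|_]; first by rewrite addn1 lt_u.
  by rewrite addn0 IH // => i /leqW/lt_u.
have ex_n : exists n, (u (X n) <= exits n (X n))%N.
  (* If [M.+1] steps all respected the bound, they would be [M.+1] exits from vertices of [s], where
     [u] allows only [M]. *)
  pose M := (\sum_(x <- s) u x)%N.
  have [/hasP[i _]|/hasPn no_n] :=
      boolP (has (fun i => u (X i) <= exits i (X i))%N (iota 0 M.+1)).
    by exists i.
  have lt_u i : (i < M.+1)%N -> (exits i (X i) < u (X i))%N.
    by move=> le_i; rewrite ltnNge no_n // mem_iota.
  suff : (M.+1 <= M)%N by rewrite ltnn.
  apply: (@leq_trans (\sum_(x <- s) exits M.+1 x)); last first.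
    by apply: leq_sum => x _; apply: step.
  rewrite /exits exchange_big /= -[X in (X <= _)%N]card_ord -sum1_card.
  apply: leq_sum => i _; have : X i \in s by apply/u_supp/leq_trans/lt_u.
  by move=> Xi; rewrite (big_rem (X i)) //= eqxx.
case: (ex_minnP ex_n) => n ge_u min_n; exists n.
have le_u : forall x, (exits n x <= u x)%N.
  by apply: step => i lt_i; rewrite ltnNge; apply/negP => /min_n; lia.
have eq_u : exits n (X n) = u (X n) by apply/eqP; rewrite eqn_leq le_u.
suff X_n : X n = x0 by split=> //; rewrite -X_n.
(* All exits of [X n] are used up, so conservation would require [u (X n) + 1] entries there if the
   walk had not started at [X n]. *)
have := entries_le_balanced (X n) le_u; have := exits_conservation n (X n).
rewrite eqxx eq_u eq_sym; have [//|_] := eqVneq (X n) x0.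
by rewrite addn0 addn1 => ->; rewrite ltnn.
Qed.

(* An unused exit of [x] leaves its last one, to [turns x (u x)], unused; so
   that vertex is entered less than [u] prescribes and has unused exits too. *)
Lemma exits_eq_balanced (h : V -> nat) n :
  (forall x, 0 < u x -> x != x0 -> h (turns x (u x)) < h x)%N ->
  X n = x0 -> exits n x0 = u x0 -> (forall x, exits n x <= u x)%N ->
  exits n =1 u.
Proof.
move=> lt_h X_n eq_x0 le_u x; have [k] := ubnP (h x).
elim: k x => // k IH x lt_k; apply/eqP; rewrite eqn_leq le_u leqNgt /=.
apply/negP => lt_u; have [x_x0|x_x0] := eqVneq x x0.
  by rewrite x_x0 eq_x0 ltnn in lt_u.
set y := turns x (u x); have y_x : y \in m x by apply: turns_m.
have : exits n y = u y.
  apply: IH; apply: leq_trans (lt_h x _ x_x0) _ => //.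
  exact: leq_ltn_trans lt_u.
(* With the particle back at [x0], each vertex has been entered as often as exited. *)
have := exits_conservation n y; rewrite X_n entries_sent => /addIn e_y.
apply/eqP; rewrite -e_y -u_balanced neq_ltn; apply/orP; left.
rewrite !(big_rem x (_ : x \in m y)) 1?m_sym //= -addSn.
rewrite leq_add ?ltn_sent_turns //.
by apply: leq_sum => z _; apply: leq_sent.
Qed.

End Balanced.
End Walk.

(** * Adjacency, neighbours and balls in the lattice *)

Section Lattice.
Variable d : nat.
Implicit Types x y : 'rV[int]_d.

Lemma lattice_adjP x y :
  reflect (exists2 i, `|x 0%R i - y 0%R i|%N = 1%N
                    & forall j, j != i -> x 0 j = y 0 j)
          (lattice_adj x y).
Proof.
apply: (iffP eqP) => [sum1|[i abs_i eq_j]]; last first.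
  rewrite (bigD1 i) //= big1 => [|j /eq_j->]; last by rewrite subrr expr0n.
  by rewrite addr0; nia.
have [i /eqP xi|eq_xy] := pickP (fun i => x 0 i - y 0 i != 0); last first.
  move: sum1; rewrite big1 // => i _.
  by rewrite (eqP (negbFE (eq_xy i))) expr0n.
have sq_ge0 : forall j, 0 <= (x 0 j - y 0 j) ^+ 2 by move=> j; apply: sqr_ge0.
move: sum1; rewrite (bigD1 i) //=; set r := \sum_(j | _) _ => sum1.
have r_ge0 : 0 <= r by apply: sumr_ge0.
exists i; first by nia.
have /psumr_eq0P r_eq0 : r = 0 by nia.
move=> j j_i; have := r_eq0 (fun j _ => sq_ge0 j) j j_i; nia.
Qed.

Lemma lattice_adj_sym x y : lattice_adj x y = lattice_adj y x.
Proof.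
apply/lattice_adjP/lattice_adjP => -[i abs_i eq_j];
  by exists i => [|j /eq_j//]; lia.
Qed.

Lemma leq_sup_norm x i : (`|x 0%R i| <= sup_norm x)%N.
Proof. exact: (@leq_bigmax _ (fun i => `|x 0%R i|%N)). Qed.

Lemma size_lattice_nbrs (s : seq 'rV[int]_d) x :
  uniq s -> (forall y, (y \in s) = lattice_adj x y) -> size s = (2 * d)%N.
Proof.
move=> s_uniq mem_s.
pose nb (i : 'I_d) (b : bool) := x + (-1) ^+ b *: delta_mx 0 i.
have nbE i b j : nb i b 0 j = x 0 j + (-1) ^+ b * (j == i)%:R.
  by rewrite !mxE eqxx /= eq_sym.
pose t := [seq nb i b | i <- enum 'I_d, b <- [:: false; true]].
have /perm_size-> : perm_eq s t; last first.
  by rewrite size_allpairs size_enum_ord mulnC.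
apply: uniq_perm => //.
  apply: allpairs_uniq => //; first exact: enum_uniq.
  move=> [i b] [i' b'] _ _ /= /rowP eq_nb.
  have := eq_nb i; rewrite !nbE eqxx; have [<-|] := eqVneq i i'.
    by case: b {eq_nb} => [] ; case: b' => //=; lia.
  by case: b {eq_nb} => [] ; case: b' => //=; lia.
move=> y; rewrite mem_s; apply/lattice_adjP/allpairsP => [[i abs_i eq_j]|].
  exists (i, x 0 i > y 0 i); rewrite mem_enum; split=> //=.
    by case: (_ < _); rewrite !inE.
  apply/rowP => j; rewrite nbE; have [->|/eq_j->] := eqVneq j i.
    by case: ltP => //=; lia.
  by case: (_ < _); rewrite /=; lia.
move=> [[i b] [_ _ /= ->]]; exists i => [|j]; rewrite nbE ?eqxx.
  by case: b => /=; lia.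
by move=> /negPf->; rewrite mulr0 addr0.
Qed.

Lemma sup_norm_ball k : exists s : seq 'rV[int]_d,
  forall x, (sup_norm x <= k)%N -> x \in s.
Proof.
exists [seq \row_i ((f i : nat)%:Z - k%:Z) | f : {ffun 'I_d -> 'I_(k + k).+1}].
move=> x le_k; apply/codomP; exists [ffun i => inord `|(x 0 i + k%:Z)%R|%N].
apply/rowP => i; rewrite !mxE ffunE; move/(leq_trans (leq_sup_norm x i)): le_k.
by move: (x 0 i) => /= a le_a; rewrite inordK; lia.
Qed.

(** Serves as the potential that excludes cycles: decreasing one of several maximal entries lowers
    it, but not the sup norm. *)
Definition l1_norm x : nat := (\sum_i `|x 0%R i|)%N.

End Lattice.

(** * Decreasing a largest entry *)

Section Inward.
Variables (d : nat) (d_gt0 : (0 < d)%N).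
Implicit Types x y : 'rV[int]_d.

Definition argmax x : 'I_d := [arg max_(i > Ordinal d_gt0) `|x 0%R i|%N].

Lemma sup_normE x : sup_norm x = `|x 0%R (argmax x)|%N.
Proof. exact: bigmax_eq_arg. Qed.

Lemma sup_norm_eq0 x : (sup_norm x == 0%N) = (x == 0).
Proof.
apply/eqP/eqP => [x0|->]; last by rewrite sup_normE mxE.
apply/rowP => i; have := leq_sup_norm x i.
by rewrite x0 mxE leqn0 absz_eq0 => /eqP.
Qed.

Lemma alphaP x :
  reflect (x != 0 /\ forall j, j != argmax x -> (`|x 0%R j| < sup_norm x)%N)
          (alpha x != 0)%N.
Proof.
rewrite eqb0 negbK; apply: (iffP andP) => -[x_neq0].
  move=> /existsP[i /forallP max_i]; split=> // j.
  suff am : argmax x = i.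
    by rewrite sup_normE am => j_i; have := max_i j; rewrite j_i; lia.
  apply/eqP/negPn/negP => ai; have := max_i (argmax x); rewrite ai /=.
  by have := leq_sup_norm x i; rewrite sup_normE; lia.
move=> lt_j; split=> //; apply/existsP; exists (argmax x); apply/forallP => j.
by apply/implyP => /lt_j; rewrite sup_normE; lia.
Qed.

(** Ties are broken by the fixed choice in [argmax]; at 0 the sign vanishes, so [inward 0 = 0]. *)
Definition inward x : 'rV[int]_d :=
  \row_j (if j == argmax x then x 0 j - Num.sg (x 0 j) else x 0 j).

Lemma inward_argmax x : x != 0 ->
  `|inward x 0%R (argmax x)|.+1%N = sup_norm x /\
  `|x 0%R (argmax x) - inward x 0%R (argmax x)|%N = 1%N.
Proof. by rewrite -sup_norm_eq0 sup_normE mxE eqxx; lia. Qed.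

Lemma inward_neq x j : j != argmax x -> inward x 0 j = x 0 j.
Proof. by rewrite mxE => /negPf->. Qed.

Lemma inward_adj x : x != 0 -> lattice_adj x (inward x).
Proof.
move=> /inward_argmax[_ abs1]; apply/lattice_adjP; exists (argmax x) => //.
by move=> j /inward_neq.
Qed.

Lemma l1_norm_inward x : x != 0 -> (l1_norm (inward x) < l1_norm x)%N.
Proof.
move=> /inward_argmax[lt_x _].
rewrite /l1_norm !(bigD1 (argmax x) (P := xpredT)) //= -addSn leq_add //.
  by rewrite lt_x sup_normE.
by apply: leq_sum => j /inward_neq->.
Qed.

Lemma lattice_adj_sup_norm x y :
  lattice_adj x y -> (sup_norm y <= (sup_norm x).+1)%N.
Proof.
move=> /lattice_adjP[i abs_i eq_j]; rewrite sup_normE.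
have := leq_sup_norm x (argmax y).
by have [->|/eq_j->] := eqVneq (argmax y) i; have := leq_sup_norm x i; lia.
Qed.

(** A unit step changes one entry, so the norm grows only if that entry becomes the unique maximum
    of [y]; undoing the step is then [inward]. *)
Lemma sup_normS_adj x y : lattice_adj x y ->
  (sup_norm y == (sup_norm x).+1) = (alpha y != 0)%N && (inward y == x).
Proof.
move=> /lattice_adjP[i abs_i eq_j].
apply/eqP/andP => [norm_y|[/alphaP[y_neq0 lt_j] /eqP <-]]; last first.
  have [lt_y _] := inward_argmax y_neq0; rewrite -lt_y; congr S.
  apply/eqP; rewrite eqn_leq leq_sup_norm sup_normE /=.
  have [->//|/[dup]/lt_j lt_a /inward_neq->] :=
    eqVneq (argmax (inward y)) (argmax y).
  by move: lt_a; rewrite -lt_y ltnS.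
have y_neq0 : y != 0 by rewrite -sup_norm_eq0 norm_y.
have arg_y : argmax y = i.
  apply/eqP/negPn/negP => /eq_j; have := leq_sup_norm x (argmax y).
  by move: norm_y; rewrite sup_normE; lia.
have [lt_y abs_y] := inward_argmax y_neq0; split.
  apply/alphaP; split=> // j; rewrite arg_y => /eq_j<-.
  by rewrite norm_y ltnS leq_sup_norm.
apply/eqP/rowP => j; have [->|j_i] := eqVneq j i; last first.
  by rewrite inward_neq ?arg_y // eq_j.
have := leq_sup_norm x i; move: norm_y lt_y abs_y; rewrite sup_normE arg_y.
by move: abs_i; move: (inward y 0 i) (x 0 i) (y 0 i) => /= a b c; lia.
Qed.

End Inward.

(** * The recurrent configuration and its odometer *)

Section Config.
Variables (d : nat) (d_gt0 : (0 < d)%N) (m : 'rV[int]_d -> seq 'rV[int]_d).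
Hypothesis m_mech : is_rotor_mechanism (@lattice_adj d) m.
Implicit Types x y : 'rV[int]_d.
Local Notation inward := (inward d_gt0).

Lemma mech_uniq x : uniq (m x). Proof. by case: (m_mech x). Qed.

Lemma mem_mech x y : (y \in m x) = lattice_adj x y.
Proof. by case: (m_mech x). Qed.

Lemma mech_sym x y : (y \in m x) = (x \in m y).
Proof. by rewrite !mem_mech lattice_adj_sym. Qed.

Lemma size_mech x : size (m x) = (2 * d)%N.
Proof. exact: (size_lattice_nbrs (mech_uniq x) (mem_mech x)). Qed.

Definition exit_dir x := if x == 0 then lattice_e1 d else inward x.

Lemma exit_dir_mech x : exit_dir x \in m x.
Proof.
rewrite mem_mech /exit_dir; have [->|/inward_adj//] := eqVneq x 0.
apply/lattice_adjP; exists (Ordinal d_gt0); first by rewrite !mxE.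
by move=> j /negPf j0; rewrite !mxE -[_ == _ :> nat]/(j == Ordinal d_gt0) j0.
Qed.

(* Whether [exit_dir x] is taken by the first exit from x or by the 2d-th one. *)
Definition exits_dir_first x := (x == 0) || (alpha x != 0)%N.

(** As the rotor turns before the move, starting at the predecessor makes [exit_dir x] the first
    exit, while starting at [exit_dir x] makes it the last of a full turn. *)
Definition config x :=
  if exits_dir_first x then prev (m x) (exit_dir x) else exit_dir x.

Lemma config_mech x : config x \in m x.
Proof. by rewrite /config; case: ifP; rewrite ?mem_prev exit_dir_mech. Qed.

Lemma turns_config x q :
  turns m config x (2 * d * q + exits_dir_first x) = exit_dir x.
Proof.
rewrite addnC /turns iterD -(size_mech x).
rewrite (iter_next_sizeM (mech_uniq x) (config_mech x)) /config.
by case: ifP => //= _; rewrite next_prev ?mech_uniq.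
Qed.

(** The test guards against truncated subtraction, which would leave [alpha x] outside the ball of
    radius [k]. *)
Definition odometer k x : nat :=
  if (sup_norm x <= k)%N then (2 * d * (k - sup_norm x) + alpha x)%N else 0%N.

Lemma sup_norm0 : sup_norm (0 : 'rV[int]_d) = 0%N.
Proof. by apply/eqP; rewrite (sup_norm_eq0 d_gt0). Qed.

Lemma alpha0 : alpha (0 : 'rV[int]_d) = 0%N.
Proof. by rewrite /alpha eqxx. Qed.

Lemma alpha_bool x : alpha x = (alpha x != 0%N).
Proof. by rewrite /alpha; case: (_ && _). Qed.

Lemma odometer0 k : odometer k 0 = (2 * d * k)%N.
Proof. by rewrite /odometer sup_norm0 alpha0 subn0 addn0. Qed.

Lemma sent_config_mul x y q : y \in m x -> sent m config y x (2 * d * q) = q.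
Proof.
move=> y_x; rewrite /sent -(size_mech y).
by rewrite (sum_next_sizeM (mech_uniq y) (config_mech y)) mech_sym y_x muln1.
Qed.

(** For [y] in the ball, full turns send [k - sup_norm y] to each neighbour. If [alpha y = 1], the
    extra exit goes to [inward y], the only neighbour of smaller norm; if [alpha y = 0], there is no
    such neighbour. *)
Lemma sent_odometer k x y : y \in m x ->
  sent m config y x (odometer k y) = (k - minn (sup_norm x) (sup_norm y))%N.
Proof.
move=> y_x; have adj_xy : lattice_adj x y by rewrite -mem_mech.
have := lattice_adj_sup_norm d_gt0 adj_xy; have := sup_normS_adj d_gt0 adj_xy.
have := turns_config y (k - sup_norm y); rewrite /odometer /exits_dir_first.
rewrite /exit_dir alpha_bool; have [y0|y_neq0] := eqVneq y 0.
  rewrite y0 in y_x *; rewrite sup_norm0 alpha0 addn0 subn0 => *.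
  by rewrite sent_config_mul.
case: (alpha y != 0)%N => /= turn eq_S le_S; last first.
  rewrite addn0; case: leqP => le_k; last by rewrite /sent big_ord0; lia.
  by rewrite sent_config_mul //; lia.
rewrite addn1 in turn; case: leqP => le_k; last by rewrite /sent big_ord0; lia.
by rewrite addn1 sentS sent_config_mul // turn; move: eq_S; case: (_ == x); lia.
Qed.

(** The flow along an edge is symmetric by [sent_odometer]. Hence [x] in the ball receives
    [k - sup_norm x] from each of its [2 * d] neighbours, and one more from [inward x] if
    [alpha x = 1]. *)
Lemma odometer_balanced k x :
  (\sum_(y <- m x) sent m config y x (odometer k y) = odometer k x)%N.
Proof.
have flow y : y \in m x -> sent m config y x (odometer k y) =
    ((k - sup_norm x) +
     ((sup_norm x <= k) && (alpha x != 0) && (y == inward x)))%N.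
  move=> y_x; have adj_yx : lattice_adj y x by rewrite -mem_mech mech_sym.
  rewrite sent_odometer //; have := sup_normS_adj d_gt0 adj_yx.
  have := lattice_adj_sup_norm d_gt0 adj_yx; rewrite -andbA [y == _]eq_sym.
  by move=> le_S <-; lia.
rewrite (eq_big_seq _ flow) big_split /= big_const_seq.
rewrite count_predT iter_addn_0 size_mech.
rewrite /odometer alpha_bool; case: leqP => le_k /=; last first.
  by rewrite big1 // addn0; lia.
rewrite mulnC; congr (_ + _)%N.
have [a_x|a_x] := boolP (alpha x != 0)%N; last by rewrite big1.
have [x_neq0 _] := alphaP d_gt0 x a_x.
transitivity (inward x \in m x : nat); last by rewrite mem_mech inward_adj.
rewrite -count_uniq_mem ?mech_uniq // -sum1_count [RHS]big_mkcond.
by apply: eq_bigr => y _ /=; case: (_ == _).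
Qed.

Lemma odometer_finite k : exists s : seq 'rV[int]_d,
  forall x, (0 < odometer k x)%N -> x \in s.
Proof.
have [s mem_s] := sup_norm_ball d k; exists s => x.
by rewrite /odometer; have [/mem_s|] := leqP (sup_norm x) k.
Qed.

Lemma last_turn_odometer k x : (0 < odometer k x)%N -> x != 0 ->
  turns m config x (odometer k x) = inward x.
Proof.
rewrite /odometer; have [_ _ x_neq0|//] := leqP (sup_norm x) k.
have := turns_config x (k - sup_norm x); rewrite /exits_dir_first /exit_dir.
by rewrite (negPf x_neq0) -alpha_bool.
Qed.

Lemma config_recurrent : recurrent_config m config.
Proof.
move=> x0; apply: exits_unbounded_recurrent.
pose unb v := forall N, exists n, (N <= exits m config x0 n v)%N.
have unb_adj v w : w \in m v -> unb v -> unb w.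
  by apply: exits_unbounded_adj;
    [exact: mech_uniq|exact: mech_sym|exact: config_mech].
have unb_x0 : unb x0.
  (* This [k] makes [odometer k x0] at least [2 * d * N], hence at least [N]. *)
  move=> N; pose k := (sup_norm x0 + N)%N; have [s supp] := odometer_finite k.
  have [n [_ eq_n _]] := least_action x0 mech_uniq mech_sym config_mech supp
    (odometer_balanced k).
  by exists n; rewrite eq_n /odometer leq_addr addKn; nia.
(* Inward steps connect every vertex to 0, and unboundedness passes along edges both ways. *)
have unb_iff x : unb x <-> unb 0.
  have [k] := ubnP (l1_norm x); elim: k x => // k IH x lt_k.
  have [->//|x_neq0] := eqVneq x 0.
  rewrite -(IH (inward x)); last first.
    by apply: leq_trans (l1_norm_inward d_gt0 x_neq0) _.
  have in_x : inward x \in m x by rewrite mem_mech inward_adj.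
  by split; apply: unb_adj => //; rewrite mech_sym.
by move=> v; apply/(unb_iff v)/(unb_iff x0).
Qed.

Lemma config_odometer k : exists n,
  is_nth_traversal (rotor_walk m config 0) 0 (lattice_e1 d) k.+1 n /\
  forall x, entries_before (rotor_walk m config 0) n x = odometer k x.
Proof.
have [s supp] := odometer_finite k.
have [n [X_n eq_0 le_n]] := least_action 0 mech_uniq mech_sym config_mech supp
    (odometer_balanced k).
have eq_n : exits m config 0 n =1 odometer k.
  apply: (exits_eq_balanced (h := @l1_norm d) mech_uniq mech_sym config_mech
    (odometer_balanced k)) => // x u_gt0 x_neq0.
  by rewrite last_turn_odometer // l1_norm_inward.
exists n; split=> [|x]; last first.
  by have := exits_conservation m config 0 n x; rewrite X_n => /addIn ->.
have e1_0 : lattice_e1 d = exit_dir 0 by rewrite /exit_dir eqxx.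
have trav_sent j :
    (\sum_(i < j)
       traverses (rotor_walk m config 0%R) 0%R (lattice_e1 d) i)%N
    = sent m config 0 (lattice_e1 d) (exits m config 0 j 0).
  elim: j => [|j IH]; first by rewrite /exits big_ord0 /sent !big_ord0.
  rewrite big_ord_recr /= IH exitsS /traverses rotor_walkS.
  by case: eqP => [->|_]; rewrite ?addn0 // addn1 sentS.
(* The first [2 * d * k] exits from 0 contain [k] traversals to [lattice_e1 d]; the next exit starts
   a new turn and is traversal number [k.+1]. *)
have turn0 : turns m config 0 (exits m config 0 n 0).+1 = lattice_e1 d.
  rewrite eq_n odometer0 e1_0 -(turns_config 0 k).
  by rewrite /exits_dir_first eqxx addn1.
split; first by rewrite /traverses rotor_walkS X_n turn0 !eqxx.
rewrite trav_sent exitsS X_n eqxx addn1 sentS turn0 eqxx eq_n odometer0.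
by rewrite sent_config_mul ?addn1 // mech_sym e1_0 exit_dir_mech.
Qed.

End Config.

Theorem theorem5 (d : nat) (d_gt0 : (0 < d)%N)
    (m : 'rV[int]_d -> seq 'rV[int]_d)
    (m_mech : is_rotor_mechanism (@lattice_adj d) m) :
  exists rho : 'rV[int]_d -> 'rV[int]_d,
    [/\ is_rotor_config (@lattice_adj d) rho,
        recurrent_config m rho &
        let X := rotor_walk m rho 0 in
        forall k : nat, exists n : nat,
          is_nth_traversal X 0 (lattice_e1 d) k.+1 n /\
          forall x : 'rV[int]_d,
            (entries_before X n x)%:Z =
              Num.max (2 * d%:Z * (k%:Z - (sup_norm x)%:Z) + (alpha x)%:Z) 0].
Proof.
exists (config d_gt0 m); split.
- by move=> x; rewrite -(mem_mech m_mech) config_mech.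
- exact: config_recurrent.
move=> X k; have [n [trav_n entries_n]] := config_odometer d_gt0 m_mech k.
exists n; split=> // x; rewrite entries_n /odometer.
(* Outside the ball this bounds the first argument of the maximum by [1 - 2 * d], which is
   negative. *)
have : (alpha x <= 1)%N by rewrite /alpha leq_b1.
move: (sup_norm x) (alpha x) => r a a_le1; case: leqP => [/subnK <-|lt_k].
  set j := (k - r)%N; rewrite addnK (_ : (j + r)%:Z - r%:Z = j%:Z); last lia.
  by rewrite max_l; nia.
by rewrite max_r //; nia.
Qed.
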